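(* Let $g$ be a positive integer, let $\mathscr{C}(gen\leq g)$ be the set of all Coe-semigroups $S$ with $g(S)\leq g$, and let $G(\mathscr{C}(gen\leq g))$ be the graph with vertex set $\mathscr{C}(gen\leq g)$ in which a pair $(S,T)$ of vertices is an edge if $T=S\cup\{F(S)-1,F(S)\}$. Then $G(\mathscr{C}(gen\leq g))$ is a tree with root $\mathbb{N}$. Furthermore, if $S\in\mathscr{C}(gen\leq g)$, then the set of sons of $S$ in the tree $G(\mathscr{C}(gen\leq g))$ is equal to: (1) the set of sons of $S$ in the tree $G(\mathscr{C})$, if $g(S)\leq g-2$; that is, the set $\{S\setminus\{x\}\mid x\text{ is an odd element of }\mathrm{msg}(S)\text{ with }x>F(S)\}$, together with the additional element $S\setminus\{F(S)+1,F(S)+2\}$ in the case that $\{F(S)+1,F(S)+2\}\subseteq\mathrm{msg}(S)$; (2) $\{S\setminus\{x\}\mid x\text{ is an odd element of }\mathrm{msg}(S)\text{ with }x>F(S)\}$, if $g(S)=g-1$; (3) the empty set, if $g(S)=g$.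
   Context: $\mathbb{N}=\{0,1,2,\ldots\}$. A numerical semigroup is a subset of $\mathbb{N}$ containing $0$, closed under addition and with finite complement in $\mathbb{N}$. A numerical semigroup $S$ is a Coe-semigroup if $\{x-1,x+1\}\subseteq S$ for every odd $x\in S$; $\mathscr{C}$ is the set of all Coe-semigroups. $F(S)=\max(\mathbb{Z}\setminus S)$ is the Frobenius number (so $F(\mathbb{N})=-1$), $g(S)$ is the cardinality of $\mathbb{N}\setminus S$ (the bare letter $g$ denotes a fixed positive integer), and $\mathrm{msg}(S)$ is the (unique, finite) minimal system of generators of $S$ as a submonoid of $(\mathbb{N},+)$. A graph is a pair $(V,E)$ with $V$ a nonempty set and $E\subseteq\{(u,v)\mid u,v\in V,\ u\neq v\}$ (edges are ordered pairs of distinct vertices). A path of length $n$ connecting $u$ and $v$ is a sequence of $n$ distinct edges $(v_0,v_1),\ldots,(v_{n-1},v_n)$ with $v_0=u$, $v_n=v$. A graph is a tree with root $r$ if for every vertex $v\neq r$ there exists a unique path connecting $v$ and $r$. If $(u,v)$ is an edge of a tree, $u$ is called a son of $v$. $G(\mathscr{C})$ is the graph with vertex set $\mathscr{C}$ and edges the pairs $(S,T)$ of distinct vertices with $T=S\cup\{F(S)-1,F(S)\}$; it is a tree with root $\mathbb{N}$. *)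

(* Defs.v *)
From mathcomp Require Import all_boot all_order all_algebra.
From mathcomp Require Import finmap boolp classical_sets cardinality.

Set Implicit Arguments.
Unset Strict Implicit.
Unset Printing Implicit Defensive.

Import Order.TTheory GRing.Theory Num.Theory.

Local Open Scope classical_set_scope.

Record graph (T : Type) := Graph {
  vertices : set T;
  edges : set (T * T);
  vertices_nonempty : vertices !=set0;
  edgesP : forall u v,
    edges (u, v) -> [/\ vertices u, vertices v & u <> v]
}.

Fixpoint walk (T : Type) (G : graph T) (u v : T) (p : seq (T * T)) : Prop :=
  if p is e :: p' then [/\ edges G e, e.1 = u & walk G e.2 v p'] else u = v.

(* The edges of a path are pairwise distinct; its vertices need not be. *)
Definition path_between (T : eqType) (G : graph T) (u v : T)
    (p : seq (T * T)) : Prop :=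
  walk G u v p /\ uniq p.

Definition tree_with_root (T : eqType) (G : graph T) (r : T) : Prop :=
  vertices G r /\
  forall v, vertices G v -> v <> r -> exists! p, path_between G v r p.

Definition sons (T : Type) (G : graph T) (v : T) : set T :=
  [set u | edges G (u, v)].

Definition submonoid (M : set nat) : Prop :=
  M 0%N /\ forall x y, M x -> M y -> M (x + y)%N.

Definition numerical_semigroup (S : set nat) : Prop :=
  submonoid S /\ finite_set (~` S).

Definition coe_semigroup : set (set nat) :=
  [set S | numerical_semigroup S /\
           forall x, odd x -> S x -> [set x.-1; x.+1] `<=` S].

Definition genus (S : set nat) : nat := #|` fset_set (~` S)|.

Definition int_set (S : set nat) : set int := Posz @` S.

(* The default value 0 is only used when the maximum does not exist, which does
   not happen for numerical semigroups. *)
Definition frobenius (S : set nat) : int :=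
  xget 0%R [set m | (~` int_set S) m /\
                    forall k, (~` int_set S) k -> (k <= m)%R].

Definition minimal_generators (S A : set nat) : Prop :=
  smallest submonoid A = S /\
  forall B, B `<` A -> smallest submonoid B <> S.

(* The default value set0 is only used when there is no minimal system of
   generators; every submonoid of nat has exactly one. *)
Definition msg (S : set nat) : set nat :=
  xget set0 [set A | minimal_generators S A].

(* Stated over int, because frobenius S - 1 (and, for S = setT, frobenius S)
   can be negative. *)
Definition frobenius_edge (S T : set nat) : Prop :=
  int_set T = int_set S `|` [set (frobenius S - 1)%R; frobenius S].

Definition frobenius_edges (V : set (set nat)) : set (set nat * set nat) :=
  [set e | [/\ V e.1, V e.2, e.1 <> e.2 & frobenius_edge e.1 e.2]].

Lemma frobenius_edgesP (V : set (set nat)) S T :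
  frobenius_edges V (S, T) -> [/\ V S, V T & S <> T].
Proof. by case. Qed.

Definition frobenius_graph (V : set (set nat)) (V0 : V !=set0) :
    graph (set nat) :=
  Graph V0 (@frobenius_edgesP V).

Definition coe_genus_le (g : nat) : set (set nat) :=
  [set S | coe_semigroup S /\ (genus S <= g)%N].

Lemma coe_semigroupT : coe_semigroup setT.
Proof. by do 2!split=> //; rewrite setCT; exact: finite_set0. Qed.

Lemma coe_semigroup_nonempty : coe_semigroup !=set0.
Proof. by exists setT; exact: coe_semigroupT. Qed.

Lemma coe_genus_le_nonempty g : coe_genus_le g !=set0.
Proof.
exists setT; split; first exact: coe_semigroupT.
by rewrite /genus setCT fset_set0 cardfs0.
Qed.

Definition coe_graph : graph (set nat) :=
  frobenius_graph coe_semigroup_nonempty.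

Definition coe_genus_graph (g : nat) : graph (set nat) :=
  frobenius_graph (coe_genus_le_nonempty g).

Definition odd_msg_sons (S : set nat) : set (set nat) :=
  [set S `\ x | x in [set x | [/\ msg S x, odd x & (frobenius S < x%:Z)%R]]].

Definition next_two (S : set nat) : set int :=
  [set (frobenius S + 1)%R; (frobenius S + 2)%R].

Definition pair_son (S : set nat) : set (set nat) :=
  [set U | next_two S `<=` int_set (msg S) /\ U = S `\` Posz @^-1` next_two S].

(* Main.v *)
(** A Coe-semigroup S other than N has odd Frobenius number F, since F + 1 lies
    in S. Adjoining F - 1 and F gives a Coe-semigroup of smaller genus, and this
    is the only edge leaving S; iterating it gives the unique path to N.
    Conversely, a son U of S is S minus {F(U)} or S minus {F(U) - 1, F(U)},
    according to whether F(U) - 1 lies in U, and the removed elements are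
    minimal generators of S because sums of smaller elements of S stay in U. The
    two kinds of sons have genus g(S) + 1 and g(S) + 2, which decides which of
    them survive the bound on the genus. *)
Require Import Defs.
From mathcomp Require Import all_boot all_order all_algebra.
From mathcomp Require Import finmap boolp classical_sets cardinality zify.

Import Order.TTheory.

Local Open Scope classical_set_scope.

(** * Atoms and minimal generators of submonoids *)

Lemma submonoidD1 (S : set nat) (x : nat) : submonoid S -> x <> 0%N ->
  (forall a b, S a -> S b -> a <> 0%N -> b <> 0%N -> x <> (a + b)%N) ->
  submonoid (S `\ x).
Proof.
move=> [S0 SD] x0 xirr; split; first by split=> // /esym.
move=> a b [Sa ax] [Sb bx]; split; first exact: SD.
move=> /= abx; have [a0|/eqP a0] := eqVneq a 0%N.
  by apply: bx; rewrite /= -abx a0.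
have [b0|/eqP b0] := eqVneq b 0%N; first by apply: ax; rewrite /= -abx b0 addn0.
exact: (xirr a b).
Qed.

(** These are the atoms of the monoid; they make [msg], defined by a choice, explicit. *)
Definition irreducibles (S : set nat) : set nat :=
  [set x | [/\ S x, x <> 0%N &
    forall a b, S a -> S b -> a <> 0%N -> b <> 0%N -> x <> (a + b)%N]].

(** A nonzero element that is not an atom splits into two strictly smaller elements, so strong
    induction applies. *)
Lemma smallest_irreducibles (S : set nat) :
  submonoid S -> smallest submonoid (irreducibles S) = S.
Proof.
move=> Ssub; apply/seteqP; split.
  by apply: smallest_sub => // x [].
move=> x; elim/ltn_ind: x => x IH Sx M [[M0 MD] irrM].
have [->//|/eqP x0] := eqVneq x 0%N.
have [irrx|] := pselect (irreducibles S x); first exact: irrM.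
move=> /not_and3P[//|//|]; move=> /existsNP[a] /existsNP[b].
move=> /not_implyP[Sa] /not_implyP[Sb] /not_implyP[a0] /not_implyP[b0].
move=> /contrapT xab; rewrite xab.
have MM : submonoid M /\ irreducibles S `<=` M by [].
by apply: MD; [apply: (IH a _ Sa M MM)|apply: (IH b _ Sb M MM)]; lia.

Qed.

(** If an atom [x] were missing from [A], then [S] without [x] would be a submonoid containing [A],
    hence all of [S]. *)
Lemma irreducibles_sub_generators (S A : set nat) :
  submonoid S -> smallest submonoid A = S -> irreducibles S `<=` A.
Proof.
move=> Ssub AS x [Sx x0 xirr]; apply: contrapT => nAx.
have AS' : A `<=` S by rewrite -AS; exact: sub_gen_smallest.
suff [_ []] : (S `\ x) x by [].
have: smallest submonoid A `<=` S `\ x.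
  apply: smallest_sub; first exact: submonoidD1.
  by move=> y Ay; split; [exact: AS'|move=> yx; apply: nAx; rewrite -yx].
by rewrite AS; apply.
Qed.

Lemma msgE (S : set nat) : submonoid S -> msg S = irreducibles S.
Proof.
move=> Ssub; apply: xget_unique; first split.
- exact: smallest_irreducibles.
- by move=> B [BA nAB] /(irreducibles_sub_generators S B Ssub).
- move=> A [AS Amin]; apply: contrapT => nA.
  have irrA := irreducibles_sub_generators S A Ssub AS.
  apply: (Amin (irreducibles S)); last exact: smallest_irreducibles.
  by split=> // Airr; apply: nA; apply/seteqP.
Qed.

(** * Frobenius number, edges and genus *)

Lemma finite_set_nat_bounded (A : set nat) :
  finite_set A -> exists n, forall k, A k -> (k <= n)%N.
Proof.
move=> finA; exists (\max_(k <- fset_set A) k)%N => k Ak.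
by apply: (leq_bigmax_seq (F := id)) => //; rewrite in_fset_set ?inE.
Qed.

Lemma int_setP (S : set nat) (n : nat) : int_set S (Posz n) <-> S n.
Proof. by split=> [[m Sm [<-]]|Sn] //; exists n. Qed.

Lemma int_set_inj : injective int_set.
Proof.
by move=> S T ST; apply/seteqP; split=> x; rewrite -!int_setP ST.
Qed.

Lemma frobenius_eq (S : set nat) (m : int) : ~ int_set S m ->
  (forall k, (m < k)%R -> int_set S k) -> frobenius S = m.
Proof.
move=> Sm Sgt.
have maxm : forall k, (~` int_set S) k -> (k <= m)%R.
  by move=> k Sk; rewrite leNgt; apply/negP => /Sgt.
apply: xget_unique => // k [Sk /(_ m Sm)] mk; apply/eqP.
by rewrite eq_le mk maxm.
Qed.

Lemma frobenius_nat_eq (S : set nat) (f : nat) : ~ S f ->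
  (forall k, (f < k)%N -> S k) -> frobenius S = Posz f.
Proof.
move=> Sf Sgt; apply: frobenius_eq; first by move/int_setP.
by move=> [k|k] // fk; apply/int_setP/Sgt.
Qed.

Lemma frobeniusT : frobenius setT = (-1)%R.
Proof.
apply: frobenius_eq => [[]//|[k|k] k1]; first by exists k.
by lia.
Qed.

Lemma frobeniusP {S : set nat} : numerical_semigroup S -> S <> setT ->
  exists f : nat,
    [/\ frobenius S = Posz f, (0 < f)%N, ~ S f & forall k, (f < k)%N -> S k].
Proof.
move=> [[S0 _] finS] ST.
have [n Sn] := finite_set_nat_bounded _ finS.
have exS : exists k, `[< ~ S k >].
  apply: contrapT => /forallNP nS; apply: ST; apply/seteqP; split=> // k _.
  by apply: contrapT => Sk; apply: (nS k); apply/asboolP.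
have ubS k : `[< ~ S k >] -> (k <= n)%N by move/asboolP; exact: Sn.
case: (ex_maxnP exS ubS) => f /asboolP Sf fmax.
have Sgt k : (f < k)%N -> S k.
  move=> fk; apply: contrapT => Sk.
  by have /fmax := asboolT Sk; rewrite leqNgt fk.
exists f; split=> //; first exact: frobenius_nat_eq.
by rewrite lt0n; apply/eqP => f0; apply: Sf; rewrite f0.
Qed.

Lemma frobenius_edgeE (S T : set nat) (f : nat) :
  frobenius S = Posz f -> (0 < f)%N ->
  frobenius_edge S T <-> T = S `|` [set f.-1; f].
Proof.
move=> Sf f0; rewrite /frobenius_edge Sf.
have -> : int_set S `|` [set (Posz f - 1)%R; Posz f] =
          int_set (S `|` [set f.-1; f]).
  apply/seteqP; split=> [k [[n Sn <-]|[->|->]]|k [n [Sn|[->|->]] <-]].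
  - by exists n => //; left.
  - by exists f.-1; [right; left|lia].
  - by exists f => //; right; right.
  - by left; exists n.
  - by right; left => /=; lia.
  - by right; right.
by split=> [/int_set_inj|->].
Qed.

(** An edge leaving [setT] would put the negative integer -1 into [int_set T]. *)
Lemma frobenius_edgeT (T : set nat) : ~ frobenius_edge setT T.
Proof.
rewrite /frobenius_edge frobeniusT => /seteqP[_] /(_ (-1)%R) [|n //].
by right; right.
Qed.

Lemma genusD1 (S : set nat) (x : nat) : finite_set (~` S) -> S x ->
  finite_set (~` (S `\ x)) /\ genus (S `\ x) = (genus S).+1.
Proof.
move=> finS Sx.
have -> : ~` (S `\ x) = x |` ~` S.
  by rewrite setDE setCI setCK setUC.
split; first by rewrite finite_setU; split=> //; exact: finite_set1.
rewrite /genus setDE setCI setCK setUC fset_setU1// cardfsU1 in_fset_set//.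
by rewrite (_ : (x \in _) = false)//; apply/negbTE/negP; rewrite inE; apply.
Qed.

Lemma genus_le (S T : set nat) : S `<=` T -> finite_set (~` S) ->
  (genus T <= genus S)%N.
Proof.
move=> ST finS; have TS : ~` T `<=` ~` S by exact: subsetC.
apply: fsubset_leq_card; rewrite -fset_set_sub//.
exact: sub_finite_set finS.
Qed.

(** * Parents and the tree property *)

Lemma coe_frobenius_odd (S : set nat) (f : nat) : coe_semigroup S ->
  ~ S f -> (forall k, (f < k)%N -> S k) -> odd f.
Proof.
move=> [_ coeS] Sf Sgt; apply: contrapT => /negP oddf; apply: Sf.
by apply: (coeS f.+1 _ (Sgt _ _)) => //=; left.
Qed.

(** Everything from [f.-1] on lies in [T], which settles sums and neighbours involving the new
    elements. Since [f.-1] may already be in [S], the genus drops by one or two; comparing [S] with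
    [T] minus [f] gives the strict inequality. *)
Lemma coe_parent (S : set nat) (f : nat) : coe_semigroup S ->
  ~ S f -> (forall k, (f < k)%N -> S k) ->
  let T := S `|` [set f.-1; f] in
  coe_semigroup T /\ (genus T < genus S)%N.
Proof.
move=> CS Sf Sgt T; have oddf := coe_frobenius_odd S f CS Sf Sgt.
have [[[S0 SD] finS] coeS] := CS.
have Tge k : (f.-1 <= k)%N -> T k.
  have [->|kf1 kf] := eqVneq k f.-1; first by right; left.
  have [->|kf'] := eqVneq k f; first by right; right.
  by left; apply: Sgt; lia.
have ST : S `<=` T by move=> x; left.
have finT : finite_set (~` T) by apply: sub_finite_set finS; exact: subsetC.
have Tf : T f by apply: Tge; lia.
split.
- split; first split=> //; first split.
  + exact: ST.
  + move=> x y [Sx|[->|->]] [Sy|[->|->]]; try by apply: Tge; lia.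
    exact/ST/SD.
  + move=> x /[swap] [[Sx|[->|->]]] oddx.
    * by move=> y /(coeS x oddx Sx); exact: ST.
    * by lia.
    * by move=> y [->|->]; apply: Tge; lia.
- have [_ <-] := genusD1 T f finT Tf; apply: genus_le => //.
  by move=> x Sx; split; [left|move=> xf; apply: Sf; rewrite -xf].
Qed.

(** This shows that the edge leaving a vertex cannot recur later in a walk from its parent, whose
    genus is strictly smaller. *)
Lemma walk_genus (g : nat) (u v : set nat) p :
  walk (coe_genus_graph g) u v p ->
  forall e, e \in p -> (genus e.1 <= genus u)%N.
Proof.
elim: p u => //= -[a b] p IH u [[[Ca _] _ ab edge] /= au /IH wp] e; subst a.
rewrite inE => /orP[/eqP->//|/wp eb]; apply: (leq_trans eb).
have [uT|uT] := pselect (u = setT).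
  by move: edge; rewrite uT => /frobenius_edgeT.
have [f [fE f0 uf ugt]] := frobeniusP Ca.1 uT.
move: edge => /(frobenius_edgeE u b f fE f0) ->.
by have [_ /ltnW] := coe_parent u f Ca uf ugt.
Qed.

Lemma coe_genus_graph_tree (g : nat) :
  tree_with_root (coe_genus_graph g) setT.
Proof.
split; first by split; [exact: coe_semigroupT|rewrite /genus setCT fset_set0].
(* The root is included, with the empty path, because the induction passes from [v] to its parent,
   which may be [setT]. *)
suff walks n v : (genus v <= n)%N -> coe_genus_le g v ->
    exists! p, path_between (coe_genus_graph g) v setT p.
  by move=> v Vv _; exact: (walks (genus v)).
elim: n v => [|n IH] v vn Vv.
all: have [vT|vT] := pselect (v = setT).
1,3: subst v; exists [::]; split=> // -[|[a b] p]//= [[[_ _ _ edge] aT _] _].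
1,2: by move: edge; rewrite aT => /frobenius_edgeT.
all: have [Cv vg] := Vv; have [f [fE f0 vf vgt]] := frobeniusP Cv.1 vT.
all: have := coe_parent v f Cv vf vgt; set T := _ `|` _ => -[CT Tlt].
  by lia.
have VT : coe_genus_le g T by split=> //; lia.
have /(IH T) := VT; case; first by lia.
move=> p [[wp up] puniq]; exists ((v, T) :: p); split; first split=> /=.
- split=> //; split=> //=; last exact/(frobenius_edgeE v T f fE f0).
  by move=> vT'; move: Tlt; rewrite -vT' ltnn.
- rewrite up andbT; apply/negP => /(walk_genus _ _ _ _ wp) /=; lia.
- move=> [|[a b] q] [] /=; first by move=> /vT.
  move=> [[_ _ _ edge] /= av wq] /andP[_ uq]; subst a.
  move: edge => /(frobenius_edgeE v b f fE f0) bT; subst b.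
  by rewrite (puniq q).
Qed.

(** * Classification of the sons *)

Lemma frobenius_lt (S : set nat) (k : nat) : numerical_semigroup S ->
  (frobenius S < Posz k)%R -> S k.
Proof.
move=> NS; have [->//|ST] := pselect (S = setT).
by have [f [-> _ _ Sgt]] := frobeniusP NS ST => fk; apply: Sgt; lia.
Qed.

(** Neighbours of odd elements are even, so removing the odd [x] keeps the Coe property. The new
    Frobenius number is [x], and [x.-1] is already in [S], so the edge leads back to [S]. *)
Lemma coe_sonD1 (S : set nat) (x : nat) : coe_semigroup S ->
  msg S x -> odd x -> (frobenius S < Posz x)%R ->
  coe_semigroup (S `\ x) /\ frobenius_edge (S `\ x) S.
Proof.
move=> [NS coeS]; rewrite (msgE _ NS.1) => -[Sx x0 xirr] oddx Fx.
split.
  split; first by split; [exact: submonoidD1 NS.1 x0 xirr|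
                          exact: (genusD1 S x NS.2 Sx).1].
  move=> y oddy [Sy _] z yz; split; first exact: coeS yz.
  by move: yz => /= [->|->]; lia.
have FU : frobenius (S `\ x) = Posz x.
  apply: frobenius_nat_eq => [[_ []]//|k xk].
  split; last by move=> /= kx; lia.
  by apply: frobenius_lt => //; lia.
apply/(frobenius_edgeE _ _ _ FU); first by lia.
apply/seteqP; split=> [k Sk|k [[]//|[->|->]//]].
  by have [->|/eqP kx] := eqVneq k x; [right; right|left].
by apply: (coeS x) => //; left.
Qed.

Lemma pair_sonP (S U : set nat) : coe_semigroup S -> pair_son S U ->
  exists f : nat, [/\ frobenius S = Posz f, odd f, ~ S f,
    irreducibles S f.+1 /\ irreducibles S f.+2 & U = (S `\ f.+2) `\ f.+1].
Proof.
move=> CS [msgS ->]; rewrite (msgE _ CS.1.1) in msgS.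
(* For [setT] the pair is 0 and 1, but 0 is not an atom. *)
have [ST|ST] := pselect (S = setT).
  have : int_set (irreducibles S) 0%R.
    by apply: msgS; left; rewrite ST frobeniusT.
  by move=> /int_setP[].
have [f [FS f0 Sf Sgt]] := frobeniusP CS.1 ST.
exists f; split=> //; first exact: coe_frobenius_odd Sgt.
  by split; apply/int_setP; apply: msgS; rewrite /next_two FS;
    [left|right] => /=; lia.
rewrite /next_two FS; apply/seteqP; split=> k /= [].
  by move=> Sk kf; split; [split=> //|] => /= k'; apply: kf; [right|left]; lia.
by move=> [Sk k2] k1; split=> //= -[] k'; [apply: k1|apply: k2]; lia.
Qed.

(** The even number [f.+1] is adjacent only to [f], which is not in [S], and to [f.+2], which is
    removed as well; hence the Coe property survives. *)
Lemma coe_sonD2 (S U : set nat) : coe_semigroup S -> pair_son S U ->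
  [/\ coe_semigroup U, frobenius_edge U S & genus U = (genus S).+2].
Proof.
move=> CS /(pair_sonP S U CS)[f [FS oddf Sf [[S1 _ irr1] [S2 _ irr2]] UE]].
have [NS coeS] := CS.
have [fin2 gen2] := genusD1 S f.+2 NS.2 S2.
have S21 : (S `\ f.+2) f.+1 by split=> //= ?; lia.
have [fin1 gen1] := genusD1 _ f.+1 fin2 S21.
split; last by rewrite UE gen1 gen2.
- split.
    split; last by rewrite UE.
    rewrite UE; apply: submonoidD1 => //; first exact: submonoidD1 NS.1 _ irr2.
    by move=> a b [Sa _] [Sb _]; exact: irr1.
  rewrite UE => y oddy [[Sy /= y2] y1] z yz.
  have Sz := coeS y oddy Sy z yz.
  by move: yz => /= [] zy; (split; first split) => //= z';
    try (by lia); apply: Sf; rewrite (_ : f = y)//; lia.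
- have FU : frobenius U = Posz f.+2.
    rewrite UE; apply: frobenius_nat_eq => [[[_ []]]//|k fk].
    split; last by move=> /= ?; lia.
    split; last by move=> /= ?; lia.
    by apply: frobenius_lt => //; lia.
  apply/(frobenius_edgeE _ _ _ FU) => //; rewrite UE /=.
  apply/seteqP; split=> [k Sk|k [[[]]//|[->|->]//]].
  have [->|/eqP k2] := eqVneq k f.+2; first by right; right.
  by have [->|/eqP k1] := eqVneq k f.+1; [right; left|left].
Qed.

Lemma coe_edge_sons (S U : set nat) : coe_semigroup S -> coe_semigroup U ->
  frobenius_edge U S -> odd_msg_sons S U \/ pair_son S U.
Proof.
move=> CS CU edge.
have [UT|UT] := pselect (U = setT).
  by move: edge; rewrite UT => /frobenius_edgeT.
have [f [FU f0 Uf Ugt]] := frobeniusP CU.1 UT.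
have oddf := coe_frobenius_odd U f CU Uf Ugt.
have SE : S = U `|` [set f.-1; f] by apply/(frobenius_edgeE U S f FU f0).
have Sf : S f by rewrite SE; right; right.
have Sf1 : S f.-1 by rewrite SE; right; left.
have Slt k : S k -> (k < f.-1)%N -> U k.
  by rewrite SE => -[//|[->|->]]; lia.
have U0 : U 0%N by case: CU => -[[]].
have US k : U k -> S k by rewrite SE; left.
(* In the first case only [f] is new in [S], and it is an atom because smaller elements of [S] lie
   in [U]. *)
have [Uf1|Uf1] := pselect (U f.-1).
  left; exists f.
    split=> //.
    + rewrite (msgE _ CS.1.1); split=> //; first by lia.
      move=> a b Sa Sb a0 b0 fab.
      have Ule k : S k -> (k < f)%N -> U k.
        move=> Sk kf; have [->//|kf1] := eqVneq k f.-1.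
        by apply: Slt => //; lia.
      by apply: Uf; rewrite fab; apply: CU.1.1.2; apply: Ule => //; lia.
    + have [->|ST] := pselect (S = setT); first by rewrite frobeniusT; lia.
      have [m [-> _ Sm Sgt]] := frobeniusP CS.1 ST.
      rewrite ltNge; apply/negP => fm; apply: Sm.
      have [->//|mf] := eqVneq m f.
      by apply/US/Ugt; lia.
  rewrite SE; apply/seteqP; split=> [k [[//|[->|->]] nf]//|k Uk].
    by case: nf.
  by split; [left|move=> kf; apply: Uf; rewrite -kf].
right.
(* Since [f] is odd, a smaller value would be 1, making [f.-1] the element 0 of [U]. *)
have f3 : (2 < f)%N.
  rewrite ltnNge; apply/negP => f2; apply: Uf1.
  by rewrite (_ : f.-1 = 0%N)//; lia.
(* The odd number [f.-2] would bring its successor [f.-1] into [U]. *)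
have Sf2 : ~ S f.-2.
  move=> /Slt Uf2; apply: Uf1.
  by apply: (CU.2 f.-2); [lia|apply: Uf2; lia|right => /=; lia].
have FS : frobenius S = Posz f.-2.
  apply: frobenius_nat_eq => // k fk.
  have [->//|kf] := eqVneq k f.
  have [->//|kf1] := eqVneq k f.-1.
  by apply/US/Ugt; lia.
have nextE k : next_two S k <-> k = Posz f.-1 \/ k = Posz f.
  by rewrite /next_two FS /=; split=> -[] ->; [left|right|left|right]; lia.
(* Excluding 1 rules out the splitting of [f] as [f.-1] plus 1, so the summands in any other
   splitting into nonzero elements of [S] are below [f.-1] and lie in [U]. *)
have U1 : ~ S 1%N.
  move=> S1; apply: Sf2; elim: f.-2 => [|n Sn]; first exact: US.
  by rewrite -addn1; exact: CS.1.1.2.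
split.
  rewrite (msgE _ CS.1.1) => k /nextE[]->; apply/int_setP; split=> //; try lia.
  - move=> a b Sa Sb a0 b0 fab; apply: Uf1; rewrite fab.
    by apply: CU.1.1.2; apply: Slt => //; lia.
  - move=> a b Sa Sb a0 b0 fab; apply: Uf.
    have a1 : a <> 1%N by move=> a1; apply: U1; rewrite -a1.
    have b1 : b <> 1%N by move=> b1; apply: U1; rewrite -b1.
    by rewrite fab; apply: CU.1.1.2; apply: Slt => //; lia.
rewrite {1}SE; apply/seteqP; split=> [k Uk|k [[//|kf] /= nk]].
  split; first by left.
  by move=> /nextE[[kf]|[kf]]; [apply: Uf1|apply: Uf]; rewrite -kf.
by exfalso; apply: nk; apply/nextE; case: kf => ->; [left|right].
Qed.

Lemma coe_sonsE (S : set nat) : coe_semigroup S ->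
  sons coe_graph S = odd_msg_sons S `|` pair_son S.
Proof.
move=> CS; apply/seteqP; split=> U.
  by move=> [CU _ _ edge]; exact: coe_edge_sons.
move=> [[x [mx oddx Fx] <-]|pU].
  have [CU edge] := coe_sonD1 S x CS mx oddx Fx.
  move: mx; rewrite (msgE _ CS.1.1) => -[Sx _ _].
  by split=> //= eqS; move: Sx; rewrite -eqS => -[_ []].
have [CU edge gU] := coe_sonD2 S U CS pU.
by split=> //= eqS; move: gU; rewrite eqS; lia.
Qed.

(** * Effect of the genus bound *)

Lemma coe_genus_sonsE (g : nat) (S : set nat) : coe_genus_le g S ->
  sons (coe_genus_graph g) S = sons coe_graph S `&` [set U | (genus U <= g)%N].
Proof.
move=> [CS Sg]; apply/seteqP; split=> U.
  by move=> [[CU Ug] _ US edge].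
by move=> [[CU _ US edge] Ug].
Qed.

Lemma genus_odd_msg_sons (S U : set nat) : coe_semigroup S ->
  odd_msg_sons S U -> genus U = (genus S).+1.
Proof.
move=> CS [x [mx _ _] <-]; apply: (genusD1 S x CS.1.2 _).2.
by move: mx; rewrite (msgE _ CS.1.1) => -[].
Qed.

Theorem theorem26 (g : nat) (g_gt0 : (0 < g)%N) :
  tree_with_root (coe_genus_graph g) [set: nat] /\
  forall S : set nat, coe_genus_le g S ->
    [/\ (genus S)%:Z <= g%:Z - 2 ->
          sons (coe_genus_graph g) S = sons coe_graph S /\
          sons coe_graph S = odd_msg_sons S `|` pair_son S,
        (genus S)%:Z = g%:Z - 1 ->
          sons (coe_genus_graph g) S = odd_msg_sons S
      & genus S = g ->
          sons (coe_genus_graph g) S = set0]%R.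
Proof.
split; first exact: coe_genus_graph_tree.
move=> S VS; have [CS _] := VS.
rewrite (coe_genus_sonsE g S VS) (coe_sonsE S CS).
have gO U := genus_odd_msg_sons S U CS.
have gP U (pU : pair_son S U) : genus U = (genus S).+2.
  by have [] := coe_sonD2 S U CS pU.
split=> Sg.
- split=> //; apply/seteqP; split=> [U []//|U sU]; split=> //=.
  by case: sU => [/gO|/gP] ->; lia.
- apply/seteqP; split=> [U [[//|/gP /= ->]]|U oU]; first by lia.
  by split; [left|rewrite /= (gO _ oU); lia].
- by apply/seteqP; split=> // U [[/gO|/gP] /= ->]; lia.
Qed.
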